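(* Let $\mu$ be the distribution of the Gibbs hard-sphere model with reference marked Poisson process law $\mu^0$ of intensity $\lambda$, and let $\mathcal P(\lambda)=\mathbb P_{\mu^0}(\mathbf X\in\mathscr A)$ be the non-overlapping probability. Let $\{(D_{n,k},\mu_{n,k},\sigma_{n,k})_{k=1}^K\}_{n\in\mathbb N_0}$, with some $K\le\infty$, be a stable importance sampling sequence, with likelihood ratios $L_{n,k}$ and $\widetilde\sigma(n)=\sum_{k=1}^K\sigma_{n,k}$. Then the importance sampling based acceptance-rejection algorithm (described in the context) generates a perfect sample of the Gibbs hard-sphere model, i.e. its output has distribution $\mu$. Furthermore, with $N\sim\mathrm{Poisson}(\lambda)$, the probability that the configuration generated in an iteration of the algorithm is accepted equals $$P_{\mathsf{acc}}(\lambda)=\frac{\mathcal P(\lambda)}{\mathbb E[\widetilde\sigma(N)]}.$$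
   Context: Let $d\ge1$, $\eta>0$, $\lambda>0$ and $R$ a non-negative random variable bounded above by a constant $\bar r>0$ with $2\bar r/\lambda^\eta<1$. $\mathscr G_n$ is the set of configurations $\{(y_1,r_1),\dots,(y_n,r_n)\}$ with $(y_i,r_i)\in[0,1]^d\times[0,\infty)$ ($y_i$ = center, $r_i$ = radius of a sphere), and $\mathscr G=\bigcup_{n\in\mathbb N_0}\mathscr G_n$. $\mu^0$ is the law on $\mathscr G$ of the marked Poisson process whose centers form a homogeneous Poisson process of intensity $\lambda$ on $[0,1]^d$ and whose radii are i.i.d. distributed as $R/\lambda^\eta$, independent of the centers. $\mathscr A\subset\mathscr G$ is the set of configurations in which no two spheres overlap (in the torus or in the Euclidean sense). The hard-sphere law $\mu$ is given by $\frac{d\mu}{d\mu^0}(\mathbf x)=I(\mathbf x\in\mathscr A)/\mathcal P(\lambda)$. Stable importance sampling sequence: for some $K\le\infty$ and every $n\in\mathbb N_0$, $(D_{n,k})_{k=1}^K$ is a partition of $\mathscr G_n$, and $(\mu_{n,k})_{k=1}^K$ is a sequence of probability measures such that, writing $\mu^0$ on $\mathscr G_n$ for the law of the marked Poisson process conditioned on having $n$ points, $\mu^0$ is absolutely continuous with respect to $\mu_{n,k}$ on $D_{n,k}\cap\mathscr A$, with likelihood ratio $L_{n,k}=\frac{d\mu^0}{d\mu_{n,k}}$ satisfying $L_{n,k}(\mathbf x)\le\sigma_{n,k}\le1$ for all $\mathbf x\in D_{n,k}\cap\mathscr A$, $k=1,\dots,K$. Algorithm: repeat independent iterations until acceptance: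 (1) generate $M$ with $\mathbb P(M=m)=\frac{1}{C_\lambda}\frac{\lambda^m\widetilde\sigma(m)}{m!}$, $m\in\mathbb N_0$, where $C_\lambda=\sum_{n\ge0}\lambda^n\widetilde\sigma(n)/n!$; (2) given $M$, generate $J_1$ with $\mathbb P(J_1=k)=\sigma_{M,k}/\widetilde\sigma(M)$, $k=1,\dots,K$; (3) generate a configuration $\mathbf X$ of $M$ points under $\mu_{M,J_1}$; (4) generate a Bernoulli variable $J_2$ with success probability $L_{M,J_1}(\mathbf X)I(\mathbf X\in D_{M,J_1}\cap\mathscr A)/\sigma_{M,J_1}$; accept if $J_2=1$. Output the accepted $\mathbf X$. *)

(* Defs.v *)
From HB Require Import structures.
From mathcomp Require Import all_boot all_order all_algebra finmap.
From mathcomp Require Import all_classical all_reals all_analysis.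

Set Implicit Arguments.
Unset Strict Implicit.
Unset Printing Implicit Defensive.

Import Order.TTheory GRing.Theory Num.Theory.
Import numFieldNormedType.Exports.

Local Open Scope classical_set_scope.
Local Open Scope ring_scope.

Definition npoints {T : choiceType} (B : set T) (x : {fset T}) : nat :=
  #|` [fset p in x | p \in B]%fset|%N.

Definition counting_events {d : measure_display} (T : measurableType d) :
    set (set {fset T}) :=
  [set E | exists (B : set T) (n : nat),
     measurable B /\ E = [set x | npoints B x = n]].
Arguments counting_events {d} T.

(* The finite subsets of T, with the sigma-algebra generated by the maps that
   count the points falling in a measurable set. *)
Definition config {d : measure_display} (T : measurableType d) : Type :=
  g_sigma_algebraType (counting_events T).
Arguments config {d} T.

Definition position (R : realType) (dim : nat) : Type := dim.-tuple R.
(* A sphere is a pair (center, radius). *)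
Definition sphere (R : realType) (dim : nat) : Type := (position R dim * R)%type.

Definition unit_cube (R : realType) (dim : nat) : set (position R dim) :=
  [set y | forall i : 'I_dim, 0 <= tnth y i <= 1].
Arguments unit_cube : clear implicits.

(* Laws of configurations live on the ambient type config (sphere R dim) and are
   carried by these subsets: centers in the unit cube, radii non-negative. *)
Definition G_ (R : realType) (dim n : nat) : set (config (sphere R dim)) :=
  [set x : {fset sphere R dim} | #|` x|%fset = n /\
     forall p : sphere R dim, p \in x -> unit_cube R dim p.1 /\ 0 <= p.2].
Arguments G_ : clear implicits.

Definition G (R : realType) (dim : nat) : set (config (sphere R dim)) :=
  \bigcup_n G_ R dim n.
Arguments G : clear implicits.

Definition coord_dist {R : realType} (torus : bool) (a b : R) : R :=
  if torus then Num.min `|a - b| (1 - `|a - b|) else `|a - b|.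

Definition center_dist {R : realType} {dim : nat} (torus : bool)
    (y z : position R dim) : R :=
  Num.sqrt (\sum_(i < dim) coord_dist torus (tnth y i) (tnth z i) ^+ 2).

(* Tangent spheres do not overlap; a sphere inside another one does. *)
Definition overlap {R : realType} {dim : nat} (torus : bool)
    (p q : sphere R dim) : Prop :=
  center_dist torus p.1 q.1 < p.2 + q.2.

Definition nonoverlapping (R : realType) (dim : nat) (torus : bool) :
    set (config (sphere R dim)) :=
  [set x : {fset sphere R dim} | G R dim x /\
     forall p q : sphere R dim,
       p \in x -> q \in x -> p <> q -> ~ overlap torus p q].
Arguments nonoverlapping : clear implicits.

Definition mutually_independent {R : realType} {d : measure_display}
    {Omega : measurableType d} (P : probability Omega R) {I : choiceType}
    {d' : measure_display} {T : measurableType d'} (X : I -> Omega -> T) : Prop :=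
  forall (J : {fset I}) (B : I -> set T),
    (forall i, i \in J -> measurable (B i)) ->
    P (\bigcap_(i in [set` J]) X i @^-1` B i)
      = (\prod_(i <- J) fine (P (X i @^-1` B i)))%:E.

(* Lebesgue measure of a Borel set of R^n, as an iterated integral. *)
Fixpoint volume {R : realType} (n : nat) : set (n.-tuple R) -> \bar R :=
  match n with
  | 0 => fun B => \d_[tuple] B
  | m.+1 => fun B =>
      (\int[lebesgue_measure]_x
         volume [set t : m.-tuple R | B [tuple of x :: t]])%E
  end.

(* The second argument of poisson_prob is not used by the library. *)
Definition poisson_process_on_cube {R : realType} {dim : nat} (lambda : R)
    {d : measure_display} {Omega : measurableType d} (P : probability Omega R)
    (Phi : Omega -> config (position R dim)) : Prop :=
  [/\ forall (w : Omega) (y : position R dim),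
        y \in (Phi w : {fset position R dim}) -> unit_cube R dim y,
      forall B : set (position R dim), measurable B -> B `<=` unit_cube R dim ->
        forall U : set nat,
          P [set w | U (npoints B (Phi w))]
            = poisson_prob (lambda * fine (volume B)) 0 U &
      forall (n : nat) (B : 'I_n -> set (position R dim)),
        (forall i, measurable (B i) /\ B i `<=` unit_cube R dim) ->
        trivIset setT B ->
        mutually_independent P (fun i w => npoints (B i) (Phi w))].

Definition first_points {T : choiceType} (u : nat -> T) (n : nat) : {fset T} :=
  [fset p in [seq u i | i <- iota 0 n]]%fset.

(* mu0 is the law of {(Y_i, rho_i) : i < N}, where {Y_i : i < N} enumerates
   without repetition the N points of a Poisson process Phi on the cube, and the
   marks rho_i are i.i.d. with law [mark], independent of the centers. *)
Definition is_marked_poisson_law {R : realType} {dim : nat} (lambda : R)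
    (mark : set R -> \bar R) (mu0 : probability (config (sphere R dim)) R) :
    Prop :=
  exists (d : measure_display) (Omega : measurableType d)
    (P : probability Omega R) (Phi : {mfun Omega >-> config (position R dim)})
    (Y : nat -> {mfun Omega >-> position R dim})
    (rho : nat -> {mfun Omega >-> R}),
  let N w := #|` (Phi w : {fset position R dim})|%fset in
  [/\ poisson_process_on_cube lambda P Phi,
      forall w, Phi w = first_points (fun i => Y i w) (N w),
      forall (i : nat) (A : set R), measurable A -> P (rho i @^-1` A) = mark A,
      forall (n : nat) (S : set (config (position R dim)))
             (B : nat -> set (position R dim)) (A : nat -> set R),
        measurable S -> (forall i, measurable (B i)) ->
        (forall i, measurable (A i)) ->
        let E := [set w | S (Phi w) /\ forall i, (i < n)%N -> B i (Y i w)] in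
        P (E `&` [set w | forall i, (i < n)%N -> A i (rho i w)])
          = (P E * (\prod_(i < n) fine (P (rho i @^-1` A i)))%:E)%E &
      forall B : set (config (sphere R dim)), measurable B ->
        mu0 B
          = P [set w | B (first_points (fun i => (Y i w, rho i w)) (N w))]].

Definition cond_law {R : realType} {dim : nat}
    (mu0 : probability (config (sphere R dim)) R) (n : nat) :
    set (config (sphere R dim)) -> \bar R :=
  fun B => (mu0 (B `&` G_ R dim n) / mu0 (G_ R dim n))%E.

(* The law with density 1_A / P(lambda) with respect to mu0, where A is the set
   of non-overlapping configurations and P(lambda) = mu0 A. *)
Definition hard_sphere_law {R : realType} {dim : nat} (torus : bool)
    (mu0 : probability (config (sphere R dim)) R) :
    set (config (sphere R dim)) -> \bar R :=
  fun B =>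
    (\int[mu0]_(x in B) (\1_(nonoverlapping R dim torus) x
                         / fine (mu0 (nonoverlapping R dim torus)))%:E)%E.

(* {1, ..., K}, where None stands for K = oo. *)
Definition indices (K : option nat) : set nat :=
  [set k | (0 < k)%N /\ if K is Some m then (k <= m)%N : Prop else True].

(* The cells of the partition are allowed to be empty. *)
Record stable_importance_sampling {R : realType} {dim : nat} (torus : bool)
    (mu0 : probability (config (sphere R dim)) R) (K : option nat)
    (D : nat -> nat -> set (config (sphere R dim)))
    (mu : nat -> nat -> probability (config (sphere R dim)) R)
    (sigma : nat -> nat -> R)
    (L : nat -> nat -> config (sphere R dim) -> R) : Prop := {
  sis_measurable : forall n k, indices K k -> measurable (D n k) ;
  sis_cover : forall n, \bigcup_(k in indices K) D n k = G_ R dim n ;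
  sis_disjoint : forall n, trivIset (indices K) (D n) ;
  sis_support : forall n k, indices K k -> mu n k (G_ R dim n) = 1%E ;
  sis_dominated : forall n k (B : set (config (sphere R dim))),
    indices K k -> measurable B ->
    B `<=` D n k `&` nonoverlapping R dim torus ->
    mu n k B = 0%E -> cond_law mu0 n B = 0%E ;
  sis_measurable_ratio : forall n k, indices K k ->
    measurable_fun (D n k `&` nonoverlapping R dim torus) (L n k) ;
  sis_ratio_ge0 : forall n k x, indices K k ->
    (D n k `&` nonoverlapping R dim torus) x -> 0 <= L n k x ;
  sis_ratio : forall n k (B : set (config (sphere R dim))),
    indices K k -> measurable B ->
    B `<=` D n k `&` nonoverlapping R dim torus ->
    cond_law mu0 n B = (\int[mu n k]_(x in B) (L n k x)%:E)%E ;
  sis_bound : forall n k x, indices K k ->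
    (D n k `&` nonoverlapping R dim torus) x -> L n k x <= sigma n k ;
  sis_sigma : forall n k, indices K k -> 0 <= sigma n k <= 1 }.

Definition sigma_tilde {R : realType} (K : option nat)
    (sigma : nat -> nat -> R) (n : nat) : \bar R :=
  \esum_(k in indices K) (sigma n k)%:E.

Definition norm_const {R : realType} (lambda : R) (K : option nat)
    (sigma : nat -> nat -> R) : \bar R :=
  (\sum_(0 <= n <oo) (lambda ^+ n / n`!%:R)%:E * sigma_tilde K sigma n)%E.

Definition accept_prob {R : realType} {dim : nat} (torus : bool)
    (D : nat -> nat -> set (config (sphere R dim))) (sigma : nat -> nat -> R)
    (L : nat -> nat -> config (sphere R dim) -> R) (m k : nat)
    (x : config (sphere R dim)) : R :=
  L m k x * \1_(D m k `&` nonoverlapping R dim torus) x / sigma m k.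

(* Joint law of the variables (M, J1, X, J2) drawn in one iteration, each draw
   being specified conditionally on the previous ones.  The divisions are those
   of \bar R; a cell with sigma m k = 0 is drawn with probability 0. *)
Record iteration_law {R : realType} {dim : nat} (torus : bool) (lambda : R)
    (K : option nat) (D : nat -> nat -> set (config (sphere R dim)))
    (mu : nat -> nat -> probability (config (sphere R dim)) R)
    (sigma : nat -> nat -> R)
    (L : nat -> nat -> config (sphere R dim) -> R)
    {d : measure_display} {Omega : measurableType d} (P : probability Omega R)
    (M J1 : Omega -> nat) (X : Omega -> config (sphere R dim))
    (J2 : Omega -> bool) : Prop := {
  draw_M : forall m,
    P [set w | M w = m]
      = ((norm_const lambda K sigma)^-1
         * ((lambda ^+ m)%:E * sigma_tilde K sigma m / (m`!%:R)%:E))%E ;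
  draw_J1 : forall m k, indices K k ->
    P [set w | M w = m /\ J1 w = k]
      = (P [set w | M w = m] * ((sigma m k)%:E / sigma_tilde K sigma m))%E ;
  draw_X : forall m k (B : set (config (sphere R dim))),
    indices K k -> measurable B ->
    P [set w | [/\ M w = m, J1 w = k & B (X w)]]
      = (P [set w | M w = m /\ J1 w = k] * mu m k B)%E ;
  draw_J2 : forall m k (B : set (config (sphere R dim))),
    indices K k -> measurable B ->
    P [set w | [/\ M w = m, J1 w = k, B (X w) & J2 w]]
      = (\int[P]_(w in [set w | [/\ M w = m, J1 w = k & B (X w)]])
           (accept_prob torus D sigma L m k (X w))%:E)%E }.

Record algorithm_run {R : realType} {dim : nat} (torus : bool) (lambda : R)
    (K : option nat) (D : nat -> nat -> set (config (sphere R dim)))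
    (mu : nat -> nat -> probability (config (sphere R dim)) R)
    (sigma : nat -> nat -> R)
    (L : nat -> nat -> config (sphere R dim) -> R)
    {d : measure_display} {Omega : measurableType d} (P : probability Omega R)
    (M J1 : nat -> {mfun Omega >-> nat})
    (X : nat -> {mfun Omega >-> config (sphere R dim)})
    (J2 : nat -> {mfun Omega >-> bool}) : Prop := {
  run_iteration : forall i,
    iteration_law torus lambda K D mu sigma L P (M i) (J1 i) (X i) (J2 i) ;
  run_independent : mutually_independent P
    (fun (i : nat) w => (M i w, J1 i w, X i w, J2 i w)) }.

(* The configuration of the first accepted iteration; the value on runs that
   never accept is arbitrary. *)
Definition output {R : realType} {dim : nat} {Omega : Type}
    (X : nat -> Omega -> config (sphere R dim)) (J2 : nat -> Omega -> bool)
    (w : Omega) : config (sphere R dim) :=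
  match pselect (exists i, J2 i w) with
  | left accepted => X (ex_minn accepted) w
  | right _ => fset0
  end.

(* Main.v *)
From HB Require Import structures.
Require Import Defs.
From mathcomp Require Import all_boot all_order all_algebra finmap.
From mathcomp Require Import all_classical all_reals all_analysis.
From mathcomp Require Import measurable_realfun ring.

(** Conditionally on M = m and J1 = k, the configuration X has law mu_{m,k}, so
accepting it with probability L 1_{D_{m,k} `&` A} / sigma_{m,k} turns
mu_{m,k} into (1 / sigma_{m,k}) mu0(. `&` D_{m,k} `&` A | m points).  The
factor sigma_{m,k} is the one with which the cell (m, k) is drawn, and since
mu0 has m points with probability e^-lambda lambda^m / m!, every cell
contributes (e^lambda / C_lambda) mu0(. `&` D_{m,k} `&` A), with a constant
that does not depend on the cell.  Summing over the cells,
P(X \in B, J2 = 1) = (e^lambda / C_lambda) mu0(B `&` A) for every B, where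
e^-lambda C_lambda = E[sigma~(N)].  The acceptance probability is the case
B = everything; it is positive because the empty configuration does not overlap, so the
independent iterations accept almost surely, and summing the geometric series
gives the law of the output. *)

Set Implicit Arguments.
Unset Strict Implicit.
Unset Printing Implicit Defensive.

Import Order.TTheory GRing.Theory Num.Theory.
Import numFieldNormedType.Exports.

Local Open Scope classical_set_scope.
Local Open Scope ring_scope.

(** * Counting maps and empirical measures of configurations *)

Lemma measurable_fun_npoints {d : measure_display} {T : measurableType d}
    (B : set T) :
  measurable B -> measurable_fun [set: config T] (@npoints T B).
Proof.
move=> mB _ Y _; rewrite setTI.
rewrite (_ : _ @^-1` Y = \bigcup_(n in Y) [set x | npoints B x = n]).
  by apply: bigcup_measurable => n _; apply: sub_sigma_algebra; exists B, n.
apply/seteqP; split => [x Yx|x [n Yn /= xn]]; first by exists (npoints B x).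
by rewrite /= xn.
Qed.

(** Turns a count into a sum of Dirac masses at the enumerated points; the default [p0] is never
    reached, since [i] stays below the size. *)
Lemma npoints_enum {T : choiceType} (B : set T) (x : {fset T}) (p0 : T) :
  npoints B x = (\sum_(i < #|` x|%fset) (nth p0 x i \in B))%N.
Proof.
rewrite -(big_mkord xpredT (fun i => nat_of_bool (nth p0 x i \in B))).
rewrite -(big_nth p0 xpredT (fun p => nat_of_bool (p \in B))) /npoints.
transitivity (size [seq p <- x | p \in B]).
  apply/perm_size/uniq_perm; rewrite ?filter_uniq ?fset_uniq//.
  by move=> p; rewrite !inE mem_filter andbC.
by rewrite size_filter -sum1_count big_mkcond.
Qed.


Section empirical.
Context {R : realType} {d d' : measure_display}.
Context {X : measurableType d} {T : measurableType d'}.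
Variables (f : X -> config T) (mf : measurable_fun [set: X] f) (p0 : T).

(* Normalized by the number of points, so that the kernel is finite. *)
Definition empirical of measurable_fun [set: X] f :=
  fun x : X =>
  let s : {fset T} := f x in
  mscale ((#|` s|%fset%:R : R)^-1)%:nng
    (msum (fun i => \d_(nth p0 s i)) #|` s|%fset) : {measure set T -> \bar R}.

Lemma empiricalE (x : X) (B : set T) :
  empirical mf x B = ((npoints [set: T] (f x))%:R^-1 * (npoints B (f x))%:R)%:E.
Proof.
rewrite /empirical /= /mscale/= /msum sumEFin -EFinM /=.
congr ((_^-1 * _)%:E).
  by rewrite (npoints_enum _ _ p0); under eq_bigr do rewrite in_setT;
    rewrite sum1_card card_ord.
by rewrite (npoints_enum _ _ p0) natr_sum; apply: eq_bigr => i _; rewrite indicE.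
Qed.

Let measurable_empirical (B : set T) : measurable B ->
  measurable_fun [set: X] ((empirical mf)^~ B).
Proof.
move=> mB; under eq_fun do rewrite empiricalE.
have mN (C : set T) (g : nat -> R) : measurable C ->
    measurable_fun [set: X] (fun x => g (npoints C (f x))).
  move=> mC; have h : measurable_fun [set: nat] g by [].
  have h2 := measurableT_comp (measurable_fun_npoints mC) mf.
  exact: (measurableT_comp h h2).

apply/measurable_EFinP; apply: measurable_funM.
  exact: (mN _ (fun n => n%:R^-1)).
exact: (mN _ (fun n => n%:R)).
Qed.

HB.instance Definition _ :=
  isKernel.Build _ _ X T R (empirical mf) measurable_empirical.

Let empirical_uub : measure_fam_uub (empirical mf).
Proof.
(* The total mass is 0 for the empty configuration and 1 otherwise; [2] is taken because the uniform
   bound has to be strict. *)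
exists 2 => x; rewrite empiricalE lte_fin.
by have [->|n0] := eqVneq (npoints [set: T] (f x)) 0%N;
  rewrite ?mulr0// mulVf ?pnatr_eq0// ltr1n.
Qed.

HB.instance Definition _ :=
  Kernel_isFinite.Build _ _ X T R (empirical mf) empirical_uub.

(** For a non-empty configuration the integral is a positive multiple of a finite sum of
    non-negative values of [g], which vanishes only if all of them do. This turns an existential
    quantifier over points into the non-vanishing of an integral. *)
Lemma integral_empirical_neq0 (x : X) (g : T -> \bar R) :
  measurable_fun [set: T] g -> (forall p, 0 <= g p)%E ->
  (\int[empirical mf x]_p g p)%E != 0%E <->
  exists p, p \in (f x : {fset T}) /\ g p != 0%E.
Proof.
move=> mg g0; rewrite /empirical ge0_integral_mscale//.
rewrite ge0_integral_measure_sum//.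
under eq_bigr do rewrite integral_dirac// diracT mul1e.
set s : {fset T} := f x.
split=> [nz|[p [ps gp]]].
  apply: contrapT => nog; move/negP: nz; apply; rewrite big1 ?mule0// => i _.
  apply/eqP/negPn/negP => gi; apply: nog; exists (nth p0 s i).
  by split => //; exact: mem_nth.
have ip : (index p s < #|` s|%fset)%N by rewrite index_mem.
rewrite gt_eqF// mule_gt0//=.
  by rewrite lte_fin invr_gt0 ltr0n (leq_trans _ ip).
rewrite (bigD1 (Ordinal ip))//= nth_index//.
by rewrite (@lt_le_trans _ _ (g p)) ?lt0e ?gp ?g0// leeDl// sume_ge0.
Qed.

End empirical.
Arguments empirical {R d d' X T f} p0 mf.
Arguments integral_empirical_neq0 {R d d' X T f} mf p0 x {g}.

(* The number of ordered pairs of points in O, divided by the squared number of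
   points, is the integral of \1_O against two copies of the empirical measure,
   hence a measurable function of the configuration. *)
Lemma measurable_exists_pair {R : realType} {d : measure_display}
    (T : measurableType d) (O : set (T * T)) :
  measurable O ->
  measurable [set x : config T | exists p q : T,
    [/\ p \in (x : {fset T}), q \in (x : {fset T}) & O (p, q)]].
Proof.
move=> mO.
pose p0 : T := point.
have mid : measurable_fun [set: config T] (@idfun (config T)).
  exact: measurable_id.
have mfst : measurable_fun [set: config T * T] (@fst (config T) T).
  exact: measurable_fst.
(* The first point [z.2] is a parameter and the integral runs over the second one; taking the kernel
   over pairs keeps [g] jointly measurable. *)
pose g (z : config T * T) : \bar R :=
  (\int[empirical p0 mfst z]_q (\1_O (z.2, q))%:E)%E.
have g0 z : (0 <= g z)%E by apply: integral_ge0 => q _; rewrite lee_fin.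
have mg : measurable_fun [set: config T * T] g.
  apply: (measurable_fun_integral_finite_kernel
    (fun w : (config T * T) * T => (\1_O (w.1.2, w.2))%:E)) => //.
  apply/measurable_EFinP.
  apply: (measurableT_comp (f := \1_O : T * T -> R)).
    exact: measurable_indic.
  apply/measurable_fun_pairP; split => /=.
    exact: measurableT_comp measurable_snd measurable_fst.
  exact: measurable_snd.
pose h x : \bar R := (\int[empirical p0 mid x]_p g (x, p))%E.
have mh : measurable_fun [set: config T] h.
  exact: (measurable_fun_integral_finite_kernel g).
(* A pair in [O] exists exactly when the double integral [h] is non-zero. *)
rewrite (_ : [set x | _] = h @^-1` (~` [set 0%E])).
  by rewrite -[X in measurable X]setTI; apply: mh => //; exact: measurableC.
have mgx x : measurable_fun [set: T] (fun p => g (x, p)).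
  exact: measurable_fun_pair2 mg.
have mO1 p : measurable_fun [set: T] (fun q => (\1_O (p, q) : R)%:E).
  apply/measurable_EFinP; apply: (measurableT_comp (f := \1_O : T * T -> R)).
    exact: measurable_indic.
  exact: pair1_measurable.
have indic_neq0 p q : ((\1_O (p, q) : R)%:E != 0%E) = ((p, q) \in O).
  by rewrite indicE eqe pnatr_eq0; case: (_ \in O).
have inner x p : (g (x, p) != 0)%E <->
    exists q, q \in (x : {fset T}) /\ O (p, q).
  have E := integral_empirical_neq0 mfst p0 (x, p) (mO1 p)
    (fun q => ltac:(by rewrite lee_fin)).
  split=> [/E[q /= [xq]]|[q [xq Oq]]].
    by rewrite indic_neq0 inE => Oq; exists q.
  by apply/E; exists q; rewrite indic_neq0 inE.
have outer x := integral_empirical_neq0 mid p0 x (mgx x) (fun p => g0 (x, p)).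
apply/seteqP; split => x.
  move=> [p [q [xp xq Opq]]]; apply/eqP/outer.
  by exists p; split => //; apply/inner; exists q.
by move=> /eqP/outer[p [xp /inner[q [xq Opq]]]]; exists p, q.
Qed.

(** * Measurability of the sets of configurations *)

Lemma measurable_npoints_event {d : measure_display} {T : measurableType d}
    (B : set T) (U : set nat) :
  measurable B -> measurable [set x : config T | U (npoints B x)].
Proof.
by move=> mB; rewrite -[X in measurable X]setTI; exact: measurable_fun_npoints.
Qed.

Lemma measurable_unit_cube (R : realType) (dim : nat) :
  measurable (unit_cube R dim).
Proof.
rewrite (_ : unit_cube R dim = \bigcap_(i in [set: 'I_dim])
    ((fun y : position R dim => tnth y i) @^-1` `[0, 1])).
  apply: fin_bigcap_measurable => [|i _]; first exact: finite_finset.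
  by rewrite -[X in measurable X]setTI; exact: measurable_tnth.
apply/seteqP; split => y yc i; first by move=> _; rewrite /= in_itv; exact: yc.
by have := yc i I; rewrite /= in_itv.
Qed.

Arguments measurable_unit_cube : clear implicits.

Lemma npoints_eq0 {T : choiceType} (B : set T) (x : {fset T}) :
  npoints B x = 0%N <-> forall p, p \in x -> ~ B p.
Proof.
split=> [x0 p px Bp|noB].
  have := cardfs0_eq x0; move/fsetP/(_ p); rewrite !inE px.
  by rewrite mem_set.
apply/eqP; rewrite cardfs_eq0; apply/eqP/fsetP => p; rewrite !inE.
by apply/negbTE/negP => /andP[px]; rewrite inE; exact: noB.
Qed.

Lemma npointsT {T : choiceType} (x : {fset T}) : npoints [set: T] x = #|` x|%fset.
Proof.
by congr (size (enum_fset _)); apply/fsetP => p; rewrite !inE in_setT andbT.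
Qed.

Lemma measurable_G_ (R : realType) (dim n : nat) : measurable (G_ R dim n).
Proof.
pose S := (unit_cube R dim `*` `[0, +oo[) : set (sphere R dim).
have mS : measurable S.
  by apply: measurableX => //; exact: measurable_unit_cube.
(* Exactly [n] points in all and none outside [S]: two counting events. *)
rewrite (_ : G_ R dim n =
    [set x | npoints setT x = n] `&` [set x | npoints (~` S) x = 0%N]).
  apply: measurableI; first exact: (measurable_npoints_event [set n]).
  by apply: (measurable_npoints_event [set 0%N]); exact: measurableC.
apply/seteqP; split => x /=; rewrite npointsT npoints_eq0.
  by move=> [xn xS]; split => // p /xS[p1 p2]; apply; split => //=;
    rewrite in_itv/= andbT.
by move=> [xn xS]; split => // p /xS /contrapT [p1 /=]; rewrite in_itv/= andbT.
Qed.

Arguments measurable_G_ : clear implicits.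

Lemma measurable_G (R : realType) (dim : nat) : measurable (G R dim).
Proof. by apply: bigcup_measurable => n _; exact: measurable_G_. Qed.

Arguments measurable_G : clear implicits.

Lemma measurable_center_coord {R : realType} {dim : nat} (i : 'I_dim)
    (h : sphere R dim * sphere R dim -> sphere R dim) :
  measurable_fun setT h -> measurable_fun setT (fun pq => tnth (h pq).1 i).
Proof.
move=> mh; exact: measurableT_comp (measurable_tnth i)
  (measurableT_comp measurable_fst mh).
Qed.

Lemma measurable_radius {R : realType} {dim : nat}
    (h : sphere R dim * sphere R dim -> sphere R dim) :
  measurable_fun setT h -> measurable_fun setT (fun pq => (h pq).2).
Proof. by move=> mh; exact: measurableT_comp measurable_snd mh. Qed.

Lemma measurable_center_dist (R : realType) (dim : nat) (torus : bool) :
  measurable_fun [set: sphere R dim * sphere R dim]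
    (fun pq => center_dist torus pq.1.1 pq.2.1).
Proof.
have m1 := @measurable_center_coord R dim.
have msqrt : measurable_fun [set: R] (@Num.sqrt R).
  by apply: continuous_measurable_fun; exact: sqrt_continuous.
apply: (measurableT_comp msqrt).
apply: measurable_sum => i; apply: measurable_funX; rewrite /coord_dist.
have md : measurable_fun [set: sphere R dim * sphere R dim]
    (fun pq => `|tnth pq.1.1 i - tnth pq.2.1 i|).
  apply: measurableT_comp => //; apply: measurable_funB.
    exact: m1 measurable_fst.
  exact: m1 measurable_snd.
case: torus => //; apply: measurable_minr => //; exact: measurable_funB.
Qed.

(** Overlap of distinct spheres is a measurable relation, so the existence of an overlapping pair is
    an event, whose complement is taken within [G]. *)
Lemma measurable_nonoverlapping (R : realType) (dim : nat) (torus : bool) :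
  measurable (nonoverlapping R dim torus).
Proof.
pose O := [set pq : sphere R dim * sphere R dim |
  pq.1 <> pq.2 /\ overlap torus pq.1 pq.2].
have mO : measurable O.
  have m1 := @measurable_center_coord R dim.
  have m2 := @measurable_radius R dim.
  have eq_meas (f g : sphere R dim * sphere R dim -> R) :
      measurable_fun setT f -> measurable_fun setT g ->
      measurable [set pq | f pq = g pq].
    move=> mf mg.
    rewrite (_ : [set pq | _] = [set: _] `&`
      (fun pq => f pq == g pq) @^-1` [set true]).
      exact: (measurable_fun_eqr mf mg).
    by rewrite setTI; apply/seteqP; split => pq /= /eqP.
  (* Equality of two spheres is split into equality of the radii and of each center coordinate,
     which only compares real measurable functions. *)
  rewrite (_ : O = ~` ([set pq | pq.1.2 = pq.2.2] `&` \bigcap_(i in [set: 'I_dim])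
        [set pq | tnth pq.1.1 i = tnth pq.2.1 i]) `&`
      [set pq | center_dist torus pq.1.1 pq.2.1 < pq.1.2 + pq.2.2]).
    apply: measurableI.
      apply/measurableC/measurableI.
        by apply: eq_meas; apply: m2.
      apply: fin_bigcap_measurable => [|i _]; first exact: finite_finset.
      by apply: eq_meas; apply: m1.
    rewrite -[X in measurable X]setTI.
    have mlt : measurable_fun [set: sphere R dim * sphere R dim]
        (fun pq => center_dist torus pq.1.1 pq.2.1 < pq.1.2 + pq.2.2).
      apply: measurable_fun_ltr; first exact: measurable_center_dist.
      by apply: measurable_funD; apply: m2.
    exact: (mlt measurableT [set true]).
  apply/seteqP; split => -[[y r] [z s]] [/= yz olap]; split => //.
    move=> [rs ytz]; apply: yz; rewrite rs; congr pair.
    by apply: eq_from_tnth => i; exact: ytz.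
  by move=> [yz' rs]; apply: yz; split => // i _; rewrite yz'.
rewrite (_ : nonoverlapping R dim torus =
    G R dim `&` ~` [set x : config (sphere R dim) | exists p q,
      [/\ p \in (x : {fset _}), q \in (x : {fset _}) & O (p, q)]]).
  apply: measurableI; first exact: measurable_G.
  by apply: measurableC; exact: (@measurable_exists_pair R).
apply/seteqP; split => x [Gx xO]; split => //.
  by move=> [p [q [xp xq [/= pq]]]]; exact: xO.
by move=> p q xp xq pq opq; apply: xO; exists p, q.
Qed.
Arguments measurable_nonoverlapping : clear implicits.

(** * Number of spheres under the marked Poisson law, and a change of variables *)

Lemma volume_set0 {R : realType} (n : nat) : volume (set0 : set (n.-tuple R)) = 0%E.
Proof.
by elim: n => [|n IHn] /=; [exact: measure0|exact: integral0_eq].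
Qed.

(** The slice of the cube at first coordinate [x] is the cube of one dimension less if [x] lies in
    [0,1] and is empty otherwise, so induction leaves the length of [0,1]. *)
Lemma volume_unit_cube (R : realType) (n : nat) : volume (unit_cube R n) = 1%E.
Proof.
elim: n => [|n IHn] /=.
  by rewrite diracE mem_set// => -[].
transitivity (\int[lebesgue_measure]_x (\1_`[0, 1] x : R)%:E)%E; last first.
  by rewrite integral_indic//= setIT lebesgue_measure_itv/= lte_fin ltr01 oppr0 adde0.
apply: eq_integral => x _; rewrite indicE mem_setE.
have [x01|x01] := boolP (x \in `[0, 1]).
  rewrite -IHn; congr volume; apply/seteqP; split => t /= ct i.
    by have := ct (lift ord0 i); rewrite tnthS.
  have [->|i0] := eqVneq i ord0; first by rewrite tnth0; move: x01; rewrite in_itv.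
  by case: (unliftP ord0 i) i0 => [j ->|->]; rewrite ?eqxx// tnthS.
rewrite (_ : [set t | _] = set0) ?volume_set0//.
apply/seteqP; split => // t /= /(_ ord0); rewrite tnth0 => x01'.
by move: x01; rewrite in_itv/= x01'.
Qed.

Lemma poisson_prob_set1 {R : realType} (lambda : R) (k n : nat) : 0 < lambda ->
  poisson_prob lambda k [set n] = (poisson_pmf lambda n)%:E.
Proof.
by move=> l0; rewrite /poisson_prob l0 esum_set1// lee_fin poisson_pmf_ge0.
Qed.

Lemma in_first_points {T : choiceType} (u : nat -> T) (n : nat) (p : T) :
  p \in first_points u n <-> exists2 i, (i < n)%N & p = u i.
Proof.
rewrite !inE; split=> [/mapP[i]|[i ltin ->]].
  by rewrite mem_iota => ltin ->; exists i.
by apply: map_f; rewrite mem_iota.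
Qed.

Lemma card_first_points {T : choiceType} (u : nat -> T) (n : nat) :
  #|` first_points u n|%fset = n <-> uniq [seq u i | i <- iota 0 n].
Proof.
rewrite card_fseq; split=> [un|/undup_id ->]; last by rewrite size_map size_iota.
by rewrite -[uniq _]negbK -ltn_size_undup un size_map size_iota ltnn.
Qed.

(** Equal pairs have equal first components, so attaching marks creates no coincidence between
    points. *)
Lemma card_marked_points {T U : choiceType} (u : nat -> T) (v : nat -> U) (n : nat) :
  #|` first_points u n|%fset = n ->
  #|` first_points (fun i => (u i, v i)) n|%fset = n.
Proof.
move=> /card_first_points uu; apply/card_first_points.
by apply: (@map_uniq _ _ fst); rewrite -map_comp.
Qed.

(** There are as many spheres as centers, whose number is Poisson with mean [lambda] times the unit
    volume of the cube. Non-negativity of the radii, which [G_] also demands, fails only on a null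
    event. *)
Lemma marked_poisson_G_ {R : realType} {dim : nat} (lambda : R)
    (mark : set R -> \bar R) (mu0 : probability (config (sphere R dim)) R)
    (n : nat) :
  0 < lambda -> is_marked_poisson_law lambda mark mu0 ->
  mark [set r : R | r < 0] = 0%E -> mu0 (G_ R dim n) = (poisson_pmf lambda n)%:E.
Proof.
move=> l0 [d [W [P [Phi [Y [rho]]]]]] /= [[cube cnt _] PhiE markE _ law] mark0.
rewrite (law _ (measurable_G_ R dim n)).
set N := fun w => #|` (Phi w : {fset position R dim})|%fset.
have Ncube w : npoints (unit_cube R dim) (Phi w) = N w.
  rewrite /N -npointsT; congr size; congr enum_fset; apply/fsetP => p.
  rewrite !inE in_setT.
  by case pw : (p \in Phi w) => //=; apply: mem_set; exact: cube pw.
have NY w : #|` first_points (Y ^~ w) (N w)|%fset = N w by rewrite -PhiE.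
(* [Z] is the event that one of the first [n] radii is negative; it lies in a countable union of
   null events. *)
set Z := \bigcup_(i in `I_n) (rho i @^-1` [set r : R | r < 0]).
have mlt0 : measurable [set r : R | r < 0] by rewrite -set_itvNyo.
have mneg i : measurable (rho i @^-1` [set r : R | r < 0]).
  rewrite -[X in measurable X]setTI; exact: measurable_funP.
have mZ : measurable Z by exact: bigcup_measurable.
have Z0 : P Z = 0%E.
  apply/negligibleP => //.
  apply: (@negligibleS _ _ _ _ (\bigcup_i (rho i @^-1` [set r : R | r < 0]))).
    by move=> w [i _ ri]; exists i.
  apply: negligible_bigcup => i; apply/negligibleP => //.
  exact: etrans (markE i _ mlt0) mark0.
have mN : measurable [set w | N w = n].
  rewrite (_ : [set w | N w = n] =
      Phi @^-1` [set x | npoints (unit_cube R dim) x = n]).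
    rewrite -[X in measurable X]setTI; apply: (measurable_funP Phi) => //.
    apply: (measurable_npoints_event [set n]); exact: measurable_unit_cube.
  by apply/seteqP; split => w /=; rewrite Ncube.
(* The centers always lie in the cube, so only the radii can exclude a configuration with [N w = n],
   and they do so exactly on [Z]. *)
rewrite (_ : [set w | _] = [set w | N w = n] `\` Z).
  rewrite measureD//; last by rewrite ltey_eq fin_num_measure.
  rewrite [X in (_ - X)%E](_ : _ = 0%E) ?sube0; last first.
    by apply: (subset_measure0 (B := Z)) => //; exact: measurableI.
  have := cnt _ (measurable_unit_cube R dim) (@subset_refl _ _) [set n].
  rewrite volume_unit_cube mulr1 poisson_prob_set1// => <-.
  by congr (P _); apply/seteqP; split => w /=; rewrite Ncube.
have NYr w : #|` first_points (fun i => (Y i w, rho i w)) (N w)|%fset = N w.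
  exact: card_marked_points.
apply/seteqP; split => w /=.
  move=> [cardn pos]; rewrite NYr in cardn.
  split => // -[i /= ltin]; apply/negP; rewrite -leNgt.
  have [] // := pos (Y i w, rho i w).
  by apply/in_first_points; exists i => //; rewrite -/(N w) cardn.
move=> [Nn nZ]; split; first by rewrite NYr.
move=> p /in_first_points[i ltin ->]; split => /=.
  by apply: (cube w); rewrite PhiE; apply/in_first_points; exists i.
rewrite leNgt; apply/negP => rneg; apply: nZ; exists i => //=.
by rewrite -Nn.
Qed.

(** On [E] the variable [X] has the unnormalized law [c * nu], so this is a change of variables. It
    serves with [E] the event that a given cell is drawn, [nu] the proposal law of the cell and [c]
    the probability of [E]. *)
Lemma ge0_integral_comp {R : realType} {d d' : measure_display}
    {Omega : measurableType d} {T : measurableType d'}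
    (P : {measure set Omega -> \bar R}) (nu : {measure set T -> \bar R})
    (X : {mfun Omega >-> T}) (E : set Omega) (c : R) (B : set T)
    (f : T -> \bar R) :
  measurable E -> measurable B -> 0 <= c ->
  (forall A, measurable A -> P (E `&` X @^-1` A) = (c%:E * nu A)%E) ->
  measurable_fun [set: T] f -> (forall x, 0 <= f x)%E ->
  (\int[P]_(w in E `&` X @^-1` B) f (X w) = c%:E * \int[nu]_(x in B) f x)%E.
Proof.
move=> mE mB c0 PE mf f0.
have mXB : measurable (X @^-1` B).
  by rewrite -[X in measurable X]setTI; exact: measurable_funP.
have mfX : measurable_fun [set: Omega] (f \o X) by exact: measurableT_comp.
rewrite [LHS](eq_measure_integral (mrestr P mE)); last first.
  by move=> A mA AE /=; rewrite /mrestr setIidl// => x /AE[].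
(* The complement of [E] is null for the restricted measure, so the domain may be enlarged to the
   whole preimage of [B]. *)
transitivity (\int[mrestr P mE]_(w in X @^-1` B) f (X w))%E.
  rewrite [RHS](@ge0_negligible_integral _ _ _ _ _ (~` E))//.
  - by rewrite setDE setCK setIC.
  - exact: measurableC.
  - exact: measurable_funS mfX.
  - by transitivity (P (~` E `&` E)) => //; rewrite setICl measure0.
rewrite -(ge0_integral_pushforward (measurable_funPT X))//; last first.
  exact: measurable_funS mf.
rewrite -(@ge0_integral_mscale _ _ _ nu _ mB (NngNum c0))//; last first.
  exact: measurable_funS mf.
apply: eq_measure_integral => A mA _ /=.
by rewrite /mscale /pushforward /mrestr/= setIC PE.
Qed.

(** * Law of the accepted configuration in one iteration *)

Section one_iteration.
Context {R : realType} {dim : nat} {torus : bool} {lambda : R}.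
Context {mu0 : probability (config (sphere R dim)) R} {K : option nat}.
Context {D : nat -> nat -> set (config (sphere R dim))}.
Context {mu : nat -> nat -> probability (config (sphere R dim)) R}.
Context {sigma : nat -> nat -> R} {L : nat -> nat -> config (sphere R dim) -> R}.
Context {d : measure_display} {Omega : measurableType d}.
Context {P : probability Omega R} {M J1 : {mfun Omega >-> nat}}.
Context {X : {mfun Omega >-> config (sphere R dim)}} {J2 : {mfun Omega >-> bool}}.
Context (lambda_gt0 : 0 < lambda).
Context (mu0_G_ : forall n, mu0 (G_ R dim n) = (poisson_pmf lambda n)%:E).
Context (sis : stable_importance_sampling torus mu0 K D mu sigma L).
Context (iter : iteration_law torus lambda K D mu sigma L P M J1 X J2).

Local Notation A := (nonoverlapping R dim torus).
Local Notation C := (norm_const lambda K sigma).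

Lemma sigma_tilde_ge0 (m : nat) : (0 <= sigma_tilde K sigma m)%E.
Proof. by apply: esum_ge0 => k /(sis_sigma sis m)/andP[s0 _]; rewrite lee_fin. Qed.

Lemma norm_const_term_ge0 (m : nat) :
  (0 <= (lambda ^+ m / m`!%:R)%:E * sigma_tilde K sigma m)%E.
Proof.
by rewrite mule_ge0 ?sigma_tilde_ge0// lee_fin divr_ge0// exprn_ge0// ltW.
Qed.

Lemma norm_const_ge_term (m : nat) :
  ((lambda ^+ m / m`!%:R)%:E * sigma_tilde K sigma m <= C)%E.
Proof.
apply: le_trans (nneseries_lim_ge m.+1 _); last first.
  by move=> n _ _; exact: norm_const_term_ge0.
rewrite big_nat_recr//= leeDr// sume_ge0// => n _; exact: norm_const_term_ge0.
Qed.

Lemma lambda_fact_gt0 (m : nat) : 0 < lambda ^+ m / m`!%:R.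
Proof. by rewrite divr_gt0 ?exprn_gt0// ltr0n fact_gt0. Qed.

(* With C = 0 or C = +oo, the conventions 0^-1 = +oo, +oo^-1 = 0 and
   0 * +oo = 0 would give every value of M probability 0. *)
Lemma norm_const_gt0_fin : (0 < C < +oo)%E.
Proof.
have C0 : (0 <= C)%E by apply: nneseries_ge0 => m _ _; exact: norm_const_term_ge0.
have [m PM] : exists m, P [set w | M w = m] != 0%E.
  apply: contrapT => /forallNP PM0.
  suff : P [set: Omega] = 0%E.
    by rewrite probability_setT => /eqP; rewrite onee_eq0.
  apply/negligibleP => //.
  rewrite (_ : [set: Omega] = \bigcup_m [set w | M w = m]); last first.
    by apply/seteqP; split => // w _; exists (M w).
  apply: negligible_bigcup => m; apply/negligibleP.
    rewrite -[X in measurable X]setTI; exact: (measurable_funP M measurableT [set m]).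
  by apply/eqP/negPn/negP; exact: PM0.
rewrite lt0e C0 andbT; apply/andP; split.
  apply: contra PM => /eqP CE0.
  suff s0 : sigma_tilde K sigma m = 0%E.
    by rewrite (draw_M iter) s0 mule0 mul0e mule0.
  have := norm_const_ge_term m; rewrite CE0 pmule_rle0 ?lte_fin ?lambda_fact_gt0//.
  by move=> s_le0; apply/le_anti; rewrite s_le0 sigma_tilde_ge0.
rewrite ltey; apply: contra PM => /eqP CEy.
by rewrite (draw_M iter) CEy invey mul0e.
Qed.

Lemma norm_constK : (fine C)%:E = C.
Proof.
rewrite fineK// fin_numElt; have /andP[C0 ->] := norm_const_gt0_fin.
by rewrite (lt_trans _ C0)// ltNy0.
Qed.

Lemma fine_norm_const_gt0 : 0 < fine C.
Proof. by rewrite -lte_fin norm_constK; have /andP[] := norm_const_gt0_fin. Qed.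

Lemma sigma_tilde_fin (m : nat) : sigma_tilde K sigma m \is a fin_num.
Proof.
rewrite ge0_fin_numE ?sigma_tilde_ge0// ltey; apply/negP => /eqP sy.
have := norm_const_ge_term m; rewrite sy gt0_muley ?lte_fin ?lambda_fact_gt0//.
by rewrite leye_eq => /eqP Cy; have := norm_const_gt0_fin; rewrite Cy ltxx andbF.
Qed.

Lemma probability_M (m : nat) :
  P [set w | M w = m] =
  ((lambda ^+ m / m`!%:R / fine C)%:E * sigma_tilde K sigma m)%E.
Proof.
have C0 := fine_norm_const_gt0; rewrite (draw_M iter) -norm_constK.
rewrite -(fineK (sigma_tilde_fin m)) inver gt_eqF// inver pnatr_eq0 gtn_eqF ?fact_gt0//.
by rewrite -!EFinM; congr EFin; ring.
Qed.

Lemma probability_M_J1 (m k : nat) : indices K k ->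
  P [set w | M w = m /\ J1 w = k] =
  (lambda ^+ m / m`!%:R / fine C * sigma m k)%:E.
Proof.
move=> iK; rewrite (draw_J1 iter)// probability_M -(fineK (sigma_tilde_fin m)).
(* If [sigma_tilde] vanishes at [m], its inverse is infinite and cannot be cancelled; each
   [sigma m k] is then 0 and both sides vanish. *)
have [s0|s0] := eqVneq (fine (sigma_tilde K sigma m)) 0.
  have -> : sigma m k = 0; last by rewrite s0 mule0 mul0e mulr0.
  apply/le_anti; have /andP[-> _] := sis_sigma sis m iK; rewrite andbT.
  rewrite -s0 -lee_fin fineK ?sigma_tilde_fin//.
  apply: esum_ge; exists [set k]; last by rewrite fsbig_set1.
  by split => // _ ->.
by rewrite inver (negbTE s0) -!EFinM mulrAC -mulrA divfK// mulrC.
Qed.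

Lemma measurable_cell (m k : nat) : indices K k -> measurable (D m k `&` A).
Proof.
move=> iK; apply: measurableI; first exact: sis_measurable sis _ _ iK.
exact: measurable_nonoverlapping.
Qed.

Lemma accept_prob_ge0 (m k : nat) (x : config (sphere R dim)) :
  indices K k -> 0 <= accept_prob torus D sigma L m k x.
Proof.
move=> iK; rewrite /accept_prob indicE.
have [/set_mem DAx|_] := boolP (x \in _); last by rewrite mulr0 mul0r.
have /andP[s0 _] := sis_sigma sis m iK.
by rewrite mulr1 divr_ge0// (sis_ratio_ge0 sis).
Qed.

Lemma measurable_accept_prob (m k : nat) : indices K k ->
  measurable_fun [set: config (sphere R dim)] (accept_prob torus D sigma L m k).
Proof.
move=> iK; have mDA := measurable_cell m iK.
rewrite (_ : accept_prob _ _ _ _ _ _ =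
    fun x => (L m k \_ (D m k `&` A)) x * (sigma m k)^-1).
  apply: measurable_funM => //; apply/(measurable_restrictT _ mDA).
  exact: sis_measurable_ratio sis _ _ iK.
apply/funext => x; rewrite /accept_prob patchE indicE.
by case: (x \in _); rewrite ?mulr1 ?mulr0.
Qed.

Lemma accepted_cell (m k : nat) (B : set (config (sphere R dim))) :
  indices K k -> measurable B ->
  P [set w | [/\ M w = m, J1 w = k, B (X w) & J2 w]] =
  ((expR lambda / fine C)%:E * mu0 (B `&` (D m k `&` A)))%E.
Proof.
move=> iK mB; have mDA := measurable_cell m iK.
rewrite (draw_J2 iter)//.
set E := [set w | M w = m /\ J1 w = k].
rewrite (_ : [set w | _] = E `&` X @^-1` B); last first.
  by apply/seteqP; split => w; [case|case=> -[]].
have mE : measurable E.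
  rewrite (_ : E = M @^-1` [set m] `&` J1 @^-1` [set k])//.
  by apply: measurableI; rewrite -[X in measurable X]setTI; exact: measurable_funP.
have /andP[s0 _] := sis_sigma sis m iK.
have c0 : 0 <= lambda ^+ m / m`!%:R / fine C * sigma m k.
  by rewrite mulr_ge0// divr_ge0 ?ltW ?lambda_fact_gt0 ?fine_norm_const_gt0.
rewrite (ge0_integral_comp (nu := mu m k)
  (c := lambda ^+ m / m`!%:R / fine C * sigma m k)
  (f := EFin \o accept_prob torus D sigma L m k))//; last 3 first.
- move=> B' mB'; rewrite -(probability_M_J1 m iK) -(draw_X iter)//.
  by congr (P _); apply/seteqP; split => w; [case=> -[]|case].
- by apply/measurable_EFinP; exact: measurable_accept_prob.
- by move=> x; rewrite lee_fin accept_prob_ge0.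
have pmf : 0 < poisson_pmf lambda m.
  by rewrite /poisson_pmf lambda_gt0 mulr_gt0 ?expR_gt0// lambda_fact_gt0.
(* [D m k] consists of configurations of [m] points, so conditioning on their number only costs the
   Poisson weight of [m]. *)
have -> : mu0 (B `&` (D m k `&` A)) = ((poisson_pmf lambda m)%:E *
    cond_law mu0 m (B `&` (D m k `&` A)))%E.
  rewrite /cond_law mu0_G_ inver gt_eqF// muleA muleAC -EFinM mulfV ?gt_eqF// mul1e.
  congr (mu0 _); apply/esym/setIidl => x [_ [Dx _]].
  by rewrite -(sis_cover sis); exists k.
rewrite (sis_ratio sis iK); last 2 first.
- exact: measurableI.
- by move=> x [].
have L0 x : (D m k `&` A) x -> 0 <= L m k x by exact: sis_ratio_ge0 sis _ _ _ iK.
have acceptE :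
    (\int[mu m k]_(x in B) (EFin \o accept_prob torus D sigma L m k) x =
    (sigma m k)^-1%:E * \int[mu m k]_(x in B `&` (D m k `&` A)) (L m k x)%:E)%E.
  rewrite integral_mkcondr -ge0_integralZl//; last 3 first.
  - apply: measurable_funTS; apply/(measurable_restrictT _ mDA)/measurable_EFinP.
    exact: sis_measurable_ratio sis _ _ iK.
  - by move=> x _; rewrite patchE; case: ifPn => // /set_mem DAx; rewrite lee_fin L0.
  - by rewrite lee_fin invr_ge0.
  apply: eq_integral => x _; rewrite /= /accept_prob indicE patchE.
  by case: (x \in _); rewrite ?mulr1 ?mulr0 ?mul0r ?mule0// -EFinM mulrC.
(* A cell with [sigma m k = 0] is never drawn; the bound on [L] makes the likelihood ratio vanish on
   its non-overlapping part, which therefore has no mass under [mu0] either. *)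
have [sE0|s_neq0] := eqVneq (sigma m k) 0.
  rewrite sE0 mulr0 mul0e integral0_eq ?mule0// => x [_ DAx].
  apply/eqP; rewrite eqe -(le_anti (x := L m k x) (y := 0))//.
  by rewrite L0// -sE0 (sis_bound sis).
(* The factor [sigma m k] of the drawing probability cancels the one in the acceptance probability;
   what remains is [expR lambda / fine C] times the Poisson weight of [m]. *)
rewrite acceptE !muleA -!EFinM; congr (_%:E * _)%E.
rewrite /poisson_pmf lambda_gt0 expRN mulfK//.
by field; rewrite !gt_eqF ?expR_gt0 ?fine_norm_const_gt0 ?ltr0n ?fact_gt0.
Qed.

Lemma measurable_draw_M (U : set nat) : measurable [set w | U (M w)].
Proof. by rewrite -[X in measurable X]setTI; exact: (measurable_funP M measurableT). Qed.

Lemma measurable_draw_J1 (U : set nat) : measurable [set w | U (J1 w)].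
Proof. by rewrite -[X in measurable X]setTI; exact: (measurable_funP J1 measurableT). Qed.

Lemma measurable_accepted (B : set (config (sphere R dim))) :
  measurable B -> measurable [set w | B (X w) /\ J2 w].
Proof.
move=> mB; apply: (@measurableI _ _ (X @^-1` B) (J2 @^-1` [set true])).
  by rewrite -[X in measurable X]setTI; exact: measurable_funP.
by rewrite -[X in measurable X]setTI; exact: measurable_funP.
Qed.

(** Only the probabilities of the values in [indices K] are prescribed; they already add up to the
    probability of [M = m], which leaves no mass for other values. *)
Lemma draw_J1_indices (m : nat) :
  P ([set w | M w = m] `\` [set w | indices K (J1 w)]) = 0%E.
Proof.
have mM := measurable_draw_M [set m]; have mJ := measurable_draw_J1 (indices K).
have PMJ : P ([set w | M w = m] `&` [set w | indices K (J1 w)]) =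
    P [set w | M w = m].
  rewrite (_ : _ `&` _ = \bigcup_(k in indices K) [set w | M w = m /\ J1 w = k]).
    rewrite measure_bigcup; first last.
    - by move=> i j _ _ [w [[_ <-] [_ <-]]].
    - move=> k _; apply: (@measurableI _ _ [set w | M w = m] [set w | J1 w = k]) => //.
      exact: (measurable_draw_J1 [set k]).
    have s0 k : k \in indices K -> (0 <= (sigma m k)%:E)%E.
      by move=> /set_mem /(sis_sigma sis m)/andP[s0 _]; rewrite lee_fin.
    have -> : P [set w | M w = m] = (\sum_(k <oo | k \in indices K)
        (lambda ^+ m / m`!%:R / fine C)%:E * (sigma m k)%:E)%E.
      by rewrite probability_M nneseriesZl// nneseries_esum// set_mem_set.
    by apply: eq_eseriesr => k /set_mem iK; exact: probability_M_J1.
  apply/seteqP; split => w; first by move=> [Mw iK]; exists (J1 w).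
  by move=> [k iK [Mw Jk]]; rewrite /= Jk.
rewrite measureD//; last by rewrite ltey_eq fin_num_measure.
by rewrite [X in (_ - X)%E]PMJ subee// fin_num_measure.
Qed.

(** Sums [accepted_cell] over [k]: the cells partition [G_ R dim m], and the draws of [J1] outside
    [indices K] are discarded as a null event. *)
Lemma accepted_size (m : nat) (B : set (config (sphere R dim))) : measurable B ->
  P ([set w | B (X w) /\ J2 w] `&` [set w | M w = m]) =
  ((expR lambda / fine C)%:E * mu0 (B `&` A `&` G_ R dim m))%E.
Proof.
move=> mB; have mM := measurable_draw_M [set m].
have mJ := measurable_draw_J1 (indices K); have mS := measurable_accepted mB.
transitivity (P (\bigcup_(k in indices K)
    [set w | [/\ M w = m, J1 w = k, B (X w) & J2 w]])).
  rewrite (measureDI _ _ mJ)//; last exact: measurableI.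
  rewrite [X in (X + _)%E](_ : _ = 0%E) ?add0e; last first.
    apply: (subset_measure0 _ _ _ (draw_J1_indices m)).
    - by apply: measurableD => //; exact: measurableI.
    - exact: measurableD.
    - by move=> w [[_ Mw] Jw].
  congr (P _); apply/seteqP; split => w.
    by move=> [[[Bw Jw] Mw] iK]; exists (J1 w).
  by move=> [k iK [Mw Jk Bw Jw]]; rewrite /= Jk.
rewrite measure_bigcup; first last.
- by move=> i j _ _ [w [[_ <- _ _] [_ <- _ _]]].
- move=> k _; rewrite (_ : [set w | _] = [set w | B (X w) /\ J2 w] `&`
    ([set w | M w = m] `&` [set w | J1 w = k])).
    apply: measurableI => //; apply: measurableI => //.
    exact: (measurable_draw_J1 [set k]).
  by apply/seteqP; split => w; [case|case=> -[? ?] [? ?]].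
rewrite -(sis_cover sis) setI_bigcupr measure_bigcup; first last.
- by apply: trivIset_setIl; exact: sis_disjoint sis m.
- move=> k iK; apply: measurableI; last exact: sis_measurable sis _ _ iK.
  by apply: measurableI => //; exact: measurable_nonoverlapping.
rewrite -nneseriesZl//; apply: eq_eseriesr => k /set_mem iK.
by rewrite -setIA (setIC A); exact: accepted_cell.
Qed.

Lemma accepted (B : set (config (sphere R dim))) : measurable B ->
  P [set w | B (X w) /\ J2 w] = ((expR lambda / fine C)%:E * mu0 (B `&` A))%E.
Proof.
move=> mB; have mS := measurable_accepted mB.
have mBA : measurable (B `&` A).
  by apply: measurableI => //; exact: measurable_nonoverlapping.
have -> : [set w | B (X w) /\ J2 w] =
    \bigcup_m ([set w | B (X w) /\ J2 w] `&` [set w | M w = m]).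
  by apply/seteqP; split => [w Sw|w [m _ []//]]; exists (M w).
(* [A] is contained in [G], the union of the [G_ R dim m]. *)
have -> : B `&` A = \bigcup_m (B `&` A `&` G_ R dim m).
  apply/seteqP; split => [x BAx|x [m _ []//]].
  by have [_ [[m _ Gm] _]] := BAx; exists m.
rewrite measure_bigcup; first last.
- by move=> i j _ _ [w [[_ <-] [_ <-]]].
- by move=> m _; apply: measurableI => //; exact: (measurable_draw_M [set m]).
rewrite measure_bigcup; first last.
- by move=> i j _ _ [x [[_ [<- _]] [_ [<- _]]]].
- by move=> m _; apply: measurableI => //; exact: measurable_G_.
by rewrite -nneseriesZl//; apply: eq_eseriesr => m _; exact: accepted_size.
Qed.

End one_iteration.

(** * Expectation of [sigma_tilde] at a Poisson variable, and the first acceptance *)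

Lemma expectation_sigma_tilde {R : realType} (lambda : R) (K : option nat)
    (sigma : nat -> nat -> R) {d : measure_display} {Omega : measurableType d}
    (P : probability Omega R) (N : {mfun Omega >-> nat}) :
  0 < lambda -> (forall n k, indices K k -> 0 <= sigma n k) ->
  (forall U : set nat, P (N @^-1` U) = poisson_prob lambda 0 U) ->
  (\int[P]_w sigma_tilde K sigma (N w) =
    (expR (- lambda))%:E * norm_const lambda K sigma)%E.
Proof.
move=> l0 sigma0 PN.
have s0 n : (0 <= sigma_tilde K sigma n)%E.
  by apply: esum_ge0 => k iK; rewrite lee_fin sigma0.
have mN n : measurable (N @^-1` [set n]).
  by rewrite -[X in measurable X]setTI; exact: (measurable_funP N).
have TE : [set: Omega] = \bigcup_n (N @^-1` [set n]).
  by apply/seteqP; split => // w _; exists (N w).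
rewrite TE ge0_integral_bigcup//; last 2 first.
- apply: measurable_funTS.
  exact: (measurableT_comp (f := sigma_tilde K sigma) _ (measurable_funPT N)).
- by move=> i j _ _ [w [<- <-]].
rewrite -nneseriesZl; last first.
  by move=> n _; rewrite mule_ge0// lee_fin divr_ge0// exprn_ge0// ltW.
apply: eq_eseriesr => n _.
(* On the event [N = n] the integrand is constant, and the Poisson weight is the one in [norm_const]
   times exp(-lambda). *)
rewrite (eq_integral (cst (sigma_tilde K sigma n))); last first.
  by move=> w /set_mem <-.
rewrite integral_cst// [X in (_ * X)%E](PN [set n]).
rewrite poisson_prob_set1// /poisson_pmf l0.
by rewrite muleA -EFinM muleC; congr (_%:E * _)%E; ring.
Qed.

Lemma nneseries_geometric {R : realType} (a p : R) : 0 < p -> p <= 1 ->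
  (\sum_(0 <= n <oo) ((1 - p) ^+ n * a)%:E = (a / p)%:E)%E.
Proof.
move=> p0 p1; apply: cvg_lim => //.
rewrite (_ : (fun n => _) = EFin \o series (geometric a (1 - p))).
  apply: cvg_EFin; first exact: nearW.
  (* The denominator [p] is written as [1 - (1 - p)], the form it has in the limit of the series of
     ratio [1 - p]. *)
  rewrite -{2}(subKr 1 p).
  by apply: cvg_geometric_series; rewrite ger0_norm ?subr_ge0// gtrBl.
apply/funext => n; rewrite /series /= -sumEFin.
by apply: eq_bigr => i _; rewrite mulrC.
Qed.

(** Independence for the indices up to [n]: [U] fails at each of the first [n], with probability
    [1 - p], and [V] holds at the last. [U] will be acceptance and [V] acceptance with a
    configuration in a given set. *)
Lemma first_acceptance {R : realType} {d d' : measure_display}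
    {Omega : measurableType d} {T : measurableType d'}
    (P : probability Omega R) (Z : nat -> Omega -> T)
    (U V : set T) (p q : R) (n : nat) :
  mutually_independent P Z -> (forall i, measurable_fun [set: Omega] (Z i)) ->
  measurable U -> measurable V ->
  (forall i, P (Z i @^-1` U) = p%:E) -> (forall i, P (Z i @^-1` V) = q%:E) ->
  P [set w | (forall i, (i < n)%N -> ~ U (Z i w)) /\ V (Z n w)] =
    ((1 - p) ^+ n * q)%:E.
Proof.
move=> indep mZ mU mV PU PV.
have PnU i : P (Z i @^-1` (~` U)) = (1 - p)%:E.
  rewrite preimage_setC probability_setC ?PU//.
  by rewrite -[X in measurable X]setTI; exact: mZ.
pose J := [fset i in iota 0 n.+1]%fset.
have iJ i : (i \in J) = (i <= n)%N.
  by rewrite in_fset -[LHS]/(i \in iota 0 n.+1) mem_iota.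
pose B i := if (i < n)%N then ~` U else V.
have -> : [set w | (forall i, (i < n)%N -> ~ U (Z i w)) /\ V (Z n w)] =
    \bigcap_(i in [set` J]) Z i @^-1` B i.
  apply/seteqP; split => w.
    move=> [nU Vn] i /=; rewrite iJ /B => ilen.
    case: ltnP => [iltn|nlei]; first exact: nU.
    by rewrite (_ : i = n)//; apply/eqP; rewrite eqn_leq ilen.
  move=> wB; split=> [i iltn|].
    have := wB i; rewrite /B /= iltn; apply.
    by rewrite /= iJ ltnW.
  by have := wB n; rewrite /B /= ltnn; apply; rewrite /= iJ.
rewrite indep; last by move=> i _; rewrite /B; case: ifP => _ //; exact: measurableC.
have perm_J : perm_eq J (iota 0 n.+1).
  by apply: uniq_perm; rewrite ?fset_uniq ?iota_uniq// => i; rewrite !inE.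
rewrite (perm_big (index_iota 0 n.+1)) /=; last by rewrite /index_iota subn0.
rewrite big_nat_recr//= /B ltnn PV; congr ((_ * _)%:E).
rewrite -[in RHS](subn0 n) -prodr_const_nat.
by apply: eq_big_nat => i /andP[_ iltn]; rewrite iltn PnU.
Qed.


(** * Law of the output *)

Section output.
Context {R : realType} {dim : nat} {d : measure_display}.
Context {Omega : measurableType d}.
Variables (X : nat -> {mfun Omega >-> config (sphere R dim)}).
Variables (J2 : nat -> {mfun Omega >-> bool}).

Let accepted_at (B : set (config (sphere R dim))) (n : nat) : set Omega :=
  [set w | (forall i, (i < n)%N -> ~ J2 i w) /\ (B (X n w) /\ J2 n w)].

Lemma first_accepted (w : Omega) : (exists i, J2 i w) ->
  exists n, [/\ forall i, (i < n)%N -> ~ J2 i w, J2 n w & output X J2 w = X n w].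
Proof.
rewrite /output; case: pselect => // acc _; case: ex_minnP => n Jn min_n.
exists n; split => // i iltn Ji; by have := min_n _ Ji; rewrite leqNgt iltn.
Qed.

(** Splits the runs by the time of the first acceptance; those that never accept enter through the
    default value [fset0]. *)
Lemma preimage_output (B : set (config (sphere R dim))) :
  output X J2 @^-1` B =
  \bigcup_n accepted_at B n `|` [set w | ~ (exists i, J2 i w) /\ B fset0].
Proof.
apply/seteqP; split => w.
  have [acc|noacc] := pselect (exists i, J2 i w); last first.
    by move=> Bw; right; split => //; move: Bw; rewrite /= /output; case: pselect.
  have [n [nJ Jn outE]] := first_accepted acc.
  by rewrite /= outE => Bw; left; exists n.
move=> [[n _ [nJ [Bn Jn]]]|[noacc B0]] /=; last first.
  by rewrite /output; case: pselect.
have [m [nJ' Jm ->]] : exists m, [/\ forall i, (i < m)%N -> ~ J2 i w,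
    J2 m w & output X J2 w = X m w] by apply: first_accepted; exists n.
(* Two first acceptance times coincide, as the smaller one would be an acceptance before the
   larger. *)
suff -> : m = n by [].
by case: (ltngtP m n) => // [/nJ|/nJ'].
Qed.

Lemma measurable_accepts (i : nat) : measurable [set w | J2 i w].
Proof.
rewrite -[X in measurable X]setTI.
exact: (measurable_funP (J2 i) measurableT [set true]).
Qed.

Lemma measurable_never_accepts : measurable [set w | ~ (exists i, J2 i w)].
Proof.
rewrite (_ : [set w | _] = ~` \bigcup_i [set w | J2 i w]).
  by apply/measurableC/bigcup_measurable => i _; exact: measurable_accepts.
by apply/seteqP; split => w nJ [i]; [move=> _ Ji|move=> Ji]; apply: nJ; exists i.
Qed.

Lemma measurable_never_accepts_const (Q : Prop) :
  measurable [set w | ~ (exists i, J2 i w) /\ Q].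
Proof.
have [HQ|nQ] := pselect Q.
  rewrite (_ : [set w | _] = [set w | ~ (exists i, J2 i w)]).
    exact: measurable_never_accepts.
  by apply/seteqP; split => w; [case|].
rewrite (_ : [set w | _] = set0)//.
by apply/seteqP; split => w // [].
Qed.

Lemma measurable_accepted_at (B : set (config (sphere R dim))) (n : nat) :
  measurable B -> measurable (accepted_at B n).
Proof.
move=> mB; rewrite (_ : accepted_at B n =
    ~` (\bigcup_(i in `I_n) [set w | J2 i w]) `&`
    (X n @^-1` B `&` [set w | J2 n w])).
  apply: measurableI; [apply/measurableC/bigcup_measurable => i _|apply: measurableI];
    try exact: measurable_accepts.
  by rewrite -[X in measurable X]setTI; exact: measurable_funP.
apply/seteqP; split => w [nJ BJ]; split => //.
  by move=> [i iltn Ji]; exact: nJ iltn Ji.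
by move=> i iltn Ji; apply: nJ; exists i.
Qed.

Lemma measurable_output : measurable_fun [set: Omega] (output X J2).
Proof.
move=> _ B mB; rewrite setTI preimage_output; apply: measurableU.
  by apply: bigcup_measurable => n _; exact: measurable_accepted_at.
exact: measurable_never_accepts_const.
Qed.

(** [q] is the unnormalized law of the accepted configuration in one iteration and [p] its total
    mass. The geometric series over the first acceptance time gives [q B / p]; on the whole space
    this is almost sure acceptance, so the runs ending in the default value form a null event. *)
Lemma output_law (P : probability Omega R) (p : R)
    (q : set (config (sphere R dim)) -> R) :
  0 < p -> p <= 1 ->
  q setT = p ->
  (forall B n, measurable B -> P (accepted_at B n) = ((1 - p) ^+ n * q B)%:E) ->
  P [set w | exists i, J2 i w] = 1%E /\
  forall B, measurable B -> P (output X J2 @^-1` B) = (q B / p)%:E.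
Proof.
move=> p0 p1 qT PE.
have Pacc B : measurable B -> P (\bigcup_n accepted_at B n) = (q B / p)%:E.
  move=> mB; rewrite measure_bigcup; first last.
  - move=> i j _ _ [w [[nJi [_ Ji]] [nJj [_ Jj]]]].
    by case: (ltngtP i j) => // [/nJj|/nJi].
  - by move=> n _; exact: measurable_accepted_at.
  rewrite -(nneseries_geometric (q B) p0 p1); rewrite eseries_mkcond.
  by apply: eq_eseriesr => n _; rewrite in_setT; exact: PE.
have accE : [set w | exists i, J2 i w] = \bigcup_n accepted_at setT n.
  apply/seteqP; split => w; last by move=> [n _ [_ [_ Jn]]]; exists n.
  by move=> /first_accepted[n [nJ Jn _]]; exists n.
have P1 : P [set w | exists i, J2 i w] = 1%E.
  by rewrite accE Pacc// qT divff// gt_eqF.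
split => // B mB; rewrite preimage_output -Pacc//.
rewrite measureU0//.
- by apply: bigcup_measurable => n _; exact: measurable_accepted_at.
- exact: measurable_never_accepts_const.
apply: (subset_measure0 (B := [set w | ~ (exists i, J2 i w)])).
- exact: measurable_never_accepts_const.
- exact: measurable_never_accepts.
- by move=> w [].
have mE : measurable [set w | exists i, J2 i w].
  by rewrite -[X in measurable X]setCK; apply: measurableC; exact: measurable_never_accepts.
transitivity (P (~` [set w | exists i, J2 i w])) => //.
by rewrite probability_setC// P1 subee.
Qed.

End output.

(** * Values of the hard-sphere law, and conclusion *)

Lemma hard_sphere_lawE {R : realType} {dim : nat} (torus : bool)
    (mu0 : probability (config (sphere R dim)) R)
    (B : set (config (sphere R dim))) : measurable B ->
  hard_sphere_law torus mu0 B =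
  (fine (mu0 (B `&` nonoverlapping R dim torus)) /
   fine (mu0 (nonoverlapping R dim torus)))%:E.
Proof.
move=> mB; have mA := measurable_nonoverlapping R dim torus.
rewrite /hard_sphere_law; under eq_integral do rewrite EFinM.
rewrite ge0_integralZr//; last 2 first.
- by apply/measurable_EFinP; exact: measurable_indic.
- by rewrite lee_fin invr_ge0 fine_ge0.
by rewrite integral_indic// setIC EFinM fineK// fin_num_measure//; exact: measurableI.
Qed.

Lemma G_0_nonoverlapping (R : realType) (dim : nat) (torus : bool) :
  G_ R dim 0 `<=` nonoverlapping R dim torus.
Proof.
move=> x Gx; split; first by exists 0%N.
move=> p q; have [/cardfs0_eq -> _] := Gx.
by rewrite inE.
Qed.

Theorem proposition3
  (R : realType) (dim : nat) (torus : bool) (eta lambda rbar : R)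
  (hdim : (1 <= dim)%N) (heta : 0 < eta) (hlambda : 0 < lambda)
  (hrbar : 0 < rbar) (hsmall : 2 * rbar / (lambda `^ eta) < 1)
  (dR : measure_display) (OmegaR : measurableType dR)
  (PR : probability OmegaR R) (radius : {mfun OmegaR >-> R})
  (hradius : {ae PR, forall w, 0 <= radius w <= rbar})
  (mu0 : probability (config (sphere R dim)) R)
  (hmu0 : is_marked_poisson_law lambda
            (fun A : set R => PR [set w | A (radius w / (lambda `^ eta))]) mu0)
  (K : option nat) (D : nat -> nat -> set (config (sphere R dim)))
  (mu : nat -> nat -> probability (config (sphere R dim)) R)
  (sigma : nat -> nat -> R) (L : nat -> nat -> config (sphere R dim) -> R)
  (hsis : stable_importance_sampling torus mu0 K D mu sigma L)
  (d : measure_display) (Omega : measurableType d) (P : probability Omega R)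
  (M J1 : nat -> {mfun Omega >-> nat})
  (X : nat -> {mfun Omega >-> config (sphere R dim)})
  (J2 : nat -> {mfun Omega >-> bool})
  (hrun : algorithm_run torus lambda K D mu sigma L P M J1 X J2)
  (dN : measure_display) (OmegaN : measurableType dN)
  (PN : probability OmegaN R) (N : {mfun OmegaN >-> nat})
  (hN : forall U : set nat, PN (N @^-1` U) = poisson_prob lambda 0 U) :
  [/\ P [set w | exists i : nat, J2 i w] = 1%E,
      measurable_fun [set: Omega] (output X J2),
      forall B : set (config (sphere R dim)), measurable B ->
        P (output X J2 @^-1` B) = hard_sphere_law torus mu0 B &
      forall i : nat,
        P [set w | J2 i w]
          = (mu0 (nonoverlapping R dim torus)
             / \int[PN]_w sigma_tilde K sigma (N w))%E].
Proof.
have radius_lt0 :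
    PR [set w | [set r : R | r < 0] (radius w / (lambda `^ eta))] = 0%E.
  (* Division by the non-negative scale keeps a non-negative radius non-negative, so a negative
     scaled radius occurs only in the exceptional null set of [hradius]. *)
  have [Z [mZ Z0 negZ]] := hradius; apply: (subset_measure0 (B := Z)) => //.
    rewrite -[X in measurable X]setTI.
    have mr : measurable_fun [set: OmegaR] (fun w => radius w / (lambda `^ eta)).
      exact: measurable_funM.
    by apply: mr => //; rewrite -set_itvNyo.
  move=> w rw; apply: negZ => /= /andP[rw0 _]; move: rw.
  by rewrite /= ltNge divr_ge0// powR_ge0.
have mu0_G_ n := marked_poisson_G_ n hlambda hmu0 radius_lt0.
have mA := measurable_nonoverlapping R dim torus.
have iter i := run_iteration hrun i.
(* [c] is the factor common to all cells; [q B] below is the probability that one iteration accepts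
   a configuration in [B]. *)
set c : R := expR lambda / fine (norm_const lambda K sigma).
have c0 : 0 < c.
  by rewrite divr_gt0 ?expR_gt0// (fine_norm_const_gt0 hlambda hsis (iter 0%N)).
pose q B := c * fine (mu0 (B `&` nonoverlapping R dim torus)).
have Pq B i : measurable B -> P [set w | B (X i w) /\ J2 i w] = (q B)%:E.
  move=> mB; rewrite (accepted hlambda mu0_G_ hsis (iter i) mB) /q [RHS]EFinM fineK//.
  by rewrite fin_num_measure//; exact: measurableI.
have PJ2 i : P [set w | J2 i w] = (q setT)%:E.
  by rewrite -(Pq _ i measurableT); congr (P _); apply/seteqP; split => w; [|case].
have muA0 : 0 < fine (mu0 (nonoverlapping R dim torus)).
  rewrite fine_gt0// ltey_eq fin_num_measure// andbT.
  (* The empty configuration has mass exp(-lambda), which bounds the non-overlapping probability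
     from below. *)
  apply: (@lt_le_trans _ _ (mu0 (G_ R dim 0))).
    by rewrite mu0_G_ lte_fin /poisson_pmf hlambda !mulr_gt0// expR_gt0.
  apply: le_measure; rewrite ?inE//; first exact: measurable_G_.
  exact: G_0_nonoverlapping.
have q0 : 0 < q setT by rewrite /q setTI mulr_gt0.
have q1 : q setT <= 1.
  by rewrite -lee_fin -(PJ2 0%N) probability_le1//; exact: measurable_accepts.
have [|P1 Pout] := output_law (X := X) (J2 := J2) (P := P) (q := q) q0 q1 erefl.
  move=> B n mB.
  (* [T] holds the four draws of one iteration; [U] is acceptance and [V] acceptance with a
     configuration in [B]. *)
  pose T := ((nat * nat) * config (sphere R dim) * bool)%type.
  pose U := [set z : T | z.2].
  have mU : measurable U.
    rewrite -[X in measurable X]setTI.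
    have m2 : measurable_fun [set: T] snd by exact: measurable_snd.
    exact: (m2 measurableT [set true]).
  pose V := [set z : T | B z.1.2 /\ z.2].
  apply: (@first_acceptance _ _ _ _ _ P _ U V _ _ n (run_independent hrun)) => //.
  - by move=> j; do 3!apply: measurable_fun_pair => //.
  - apply: (@measurableI _ _ [set z : T | B z.1.2] U); last exact: mU.
    rewrite -[X in measurable X]setTI.
    have m12 : measurable_fun [set: T] (fun z => z.1.2).
      exact: measurableT_comp measurable_snd measurable_fst.
    exact: m12.
  - by move=> i; exact: Pq.
split.
- exact: P1.
- exact: measurable_output.
- move=> B mB; rewrite hard_sphere_lawE// Pout// /q setTI.
  by rewrite -mulf_div divff ?mul1r// gt_eqF.
(* The expectation is exp(-lambda) times [norm_const], which is the inverse of [c]. *)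
- move=> i; rewrite PJ2 (expectation_sigma_tilde hlambda _ hN); last first.
    by move=> n k iK; have /andP[] := sis_sigma hsis n iK.
  rewrite -(norm_constK hlambda hsis (iter 0%N)) -EFinM inver gt_eqF; last first.
    by rewrite mulr_gt0 ?expR_gt0// (fine_norm_const_gt0 hlambda hsis (iter 0%N)).
  rewrite -[mu0 _]fineK ?fin_num_measure// -EFinM /q setTI /c expRN invfM invrK.
  by congr EFin; ring.
Qed.
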